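(* Let $P_0$ be a probability distribution on a measurable space $\mathcal Z$, let $G:\mathbb R^d\times\mathcal Z\to\mathbb R^d$ be the clipped detached gradient field defined in the context, and let $h(\theta)=\mathbb E_{Z\sim P_0}[G(\theta,Z)]$. Assume: (U1) $\theta_0$ and $Z_1,Z_2,\dots$ are random variables on a common probability space and, with $\mathcal F_t=\sigma(\theta_0,Z_1,\dots,Z_t)$, for every $t\ge 0$ the conditional distribution of $Z_{t+1}$ given $\mathcal F_t$ is $P_0$. (U2) $G$ is (jointly) measurable and $\|G(\theta,z)\|_2\le G_0=1$ for all $\theta,z$. (U3) There are a nonempty closed convex set $\mathcal B\subseteq\mathbb R^d$, a point $\theta^\dagger\in\mathcal B$ with $h(\theta^\dagger)=0$, and $\mu>0$ such that $$\langle\theta-\theta^\dagger,h(\theta)\rangle\ge\mu\|\theta-\theta^\dagger\|_2^2\quad\text{for every }\theta\in\mathcal B.$$ (U4) The deterministic step sizes satisfy $\eta_t>0$ for all $t\ge1$, $\sum_t\eta_t=\infty$, $\sum_t\eta_t^2<\infty$, and $\eta_t\le 1/(2\mu)$ for all sufficiently large $t$. Let $\theta_0$ take values in $\mathcal B$ and define $$\theta_{t+1}=\Pi_{\mathcal B}\bigl[\theta_t-\eta_{t+1}G(\theta_t,Z_{t+1})\bigr],\qquad t\ge0,$$ where $\Pi_{\mathcal B}$ is the Euclidean projection onto $\mathcal B$. Put $G_t=G(\theta_t,Z_{t+1})$ and $\xi_{t+1}=G_t-h(\theta_t)$. Then $(\xi_{t+1})_{t\ge0}$ is a martingale difference sequence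 with respect to $(\mathcal F_{t+1})_{t\ge 0}$, i.e. $\xi_{t+1}$ is integrable, $\mathcal F_{t+1}$-measurable and $\mathbb E[\xi_{t+1}\mid\mathcal F_t]=0$ almost surely, and $\theta_t\to\theta^\dagger$ almost surely as $t\to\infty$.
   Context: A draw $Z\in\mathcal Z$ consists of a preference minibatch (prompt, preferred image, dispreferred image) together with all diffusion randomness used in one gradient calculation. Given are a loss $\ell(\theta,z;w)$, differentiable in $\theta\in\mathbb R^d$, and a map $\mathcal W_{\mathrm{ref}}$ assigning to each draw $z$ a weight array $w=\mathcal W_{\mathrm{ref}}(z)$ (computed by a frozen reference model, so not depending on $\theta$). The detached gradient is $\widetilde G(\theta,z)=\nabla_\theta\,\ell(\theta,z;w)\big|_{w=\mathcal W_{\mathrm{ref}}(z)}$: the weight array is recomputed from the same $z$ but treated as a constant in differentiation. The clipped field is $G(\theta,z)=\operatorname{Clip}_{1.0}(\widetilde G(\theta,z))$, where $\operatorname{Clip}_{1.0}(g)=g$ if $\|g\|_2\le1$ and $\operatorname{Clip}_{1.0}(g)=g/\|g\|_2$ otherwise. The result uses only the properties (U1)--(U4) of $G$ and $P_0$. *)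

(* Defs.v *)
From HB Require Import structures.
From mathcomp Require Import all_boot all_order all_algebra.
From mathcomp Require Import all_classical all_reals all_analysis.

Set Implicit Arguments.
Unset Strict Implicit.
Unset Printing Implicit Defensive.

Import Order.TTheory GRing.Theory Num.Theory.
Import numFieldNormedType.Exports.

Local Open Scope classical_set_scope.
Local Open Scope ring_scope.

(* The space R^d is 'rV[R]_d. The library norm `|_| on it is
   the sup norm, so the Euclidean inner product and norm are defined here; the
   topology of 'rV[R]_d is the usual one for either norm. *)

Section euclidean.
Context {R : realType} {d : nat}.
Implicit Types u v x : 'rV[R]_d.

Definition dot u v : R := \sum_(i < d) u ord0 i * v ord0 i.

Definition l2norm u : R := Num.sqrt (dot u u).

(* The value is unspecified when no nearest point exists, which does not happen
   for B nonempty, closed and convex. *)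
Definition proj (B : set 'rV[R]_d) x : 'rV[R]_d :=
  get [set y | B y /\ forall z, B z -> l2norm (x - y) <= l2norm (x - z)].

Definition gradient (f : 'rV[R]_d -> R) x : 'rV[R]_d :=
  \row_(i < d) 'D_(delta_mx ord0 i) f x.

Definition clip (c : R) u : 'rV[R]_d :=
  if l2norm u <= c then u else (c / l2norm u) *: u.

End euclidean.

(* The Borel sigma-algebra of R^d, generated by the open sets. *)
Section borel_rV.
Context (R : realType) (d : nat).

Let borel_set0 : <<s @open 'rV[R]_d >> set0.
Proof. exact: sigma_algebra0. Qed.

Let borel_setC (A : set 'rV[R]_d) :
  <<s @open 'rV[R]_d >> A -> <<s @open 'rV[R]_d >> (~` A).
Proof. exact: sigma_algebraC. Qed.

Let borel_bigcup (F : (set 'rV[R]_d)^nat) :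
  (forall i, <<s @open 'rV[R]_d >> (F i)) ->
  <<s @open 'rV[R]_d >> (\bigcup_i F i).
Proof. exact: sigma_algebra_bigcup. Qed.

HB.instance Definition _ := @isMeasurable.Build (sigma_display (@open 'rV[R]_d))
  'rV[R]_d <<s @open 'rV[R]_d >> borel_set0 borel_setC borel_bigcup.

End borel_rV.

(* For each draw z the weight array is recomputed from z but held constant in
   the differentiation. *)
Definition detached_gradient (R : realType) (d : nat) (Z W : Type)
    (loss : 'rV[R]_d -> Z -> W -> R) (Wref : Z -> W)
    (theta : 'rV[R]_d) (z : Z) : 'rV[R]_d :=
  let w := Wref z in gradient (fun theta' => loss theta' z w) theta.

Definition clipped_field (R : realType) (d : nat) (Z W : Type)
    (loss : 'rV[R]_d -> Z -> W -> R) (Wref : Z -> W)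
    (theta : 'rV[R]_d) (z : Z) : 'rV[R]_d :=
  clip 1 (detached_gradient loss Wref theta z).

Definition mean_field (R : realType) (d : nat) (dZ : measure_display)
    (Z : measurableType dZ) (P0 : probability Z R)
    (G : 'rV[R]_d -> Z -> 'rV[R]_d) (theta : 'rV[R]_d) : 'rV[R]_d :=
  \row_(i < d) fine 'E_P0[fun z => G theta z ord0 i].

Section conditioning.
Context {R : realType} {dO : measure_display} {Omega : measurableType dO}.
Variable P : probability Omega R.

(* Measurability of X with respect to a sigma-algebra F on Omega, possibly
   smaller than the ambient one. *)
Definition measurable_wrt (F : set (set Omega)) {dT : measure_display}
    {T : measurableType dT} (X : Omega -> T) : Prop :=
  forall A, measurable A -> F (X @^-1` A).

(* "E[X | F] = Y almost surely": Y is a version of the conditional expectation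
   of X given the sub-sigma-algebra F. *)
Definition is_condexp (F : set (set Omega)) (X Y : Omega -> R) : Prop :=
  [/\ P.-integrable setT (EFin \o X),
      P.-integrable setT (EFin \o Y),
      measurable_wrt F Y &
      forall A, F A ->
        (\int[P]_(w in A) (X w)%:E = \int[P]_(w in A) (Y w)%:E)%E].

(* The conditional distribution of X given F is the non-random measure Q, i.e.,
   P(X \in A | F) = Q(A) almost surely for every measurable A. *)
Definition conditional_distribution (F : set (set Omega))
    {dT : measure_display} {T : measurableType dT} (X : Omega -> T)
    (Q : probability T R) : Prop :=
  forall A, measurable A ->
    is_condexp F \1_(X @^-1` A) (cst (fine (Q A))).

(* xi t stands for the difference of index t + 1. Integrability and conditional
   expectation of vectors are coordinatewise. *)
Definition martingale_difference (d : nat) (F : nat -> set (set Omega))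
    (xi : nat -> Omega -> 'rV[R]_d) : Prop :=
  forall t,
  [/\ forall i, P.-integrable setT (fun w => (xi t w ord0 i)%:E),
      measurable_wrt (F t.+1) (xi t) &
      forall i, is_condexp (F t) (fun w => xi t w ord0 i) (cst 0)].

End conditioning.

(* sigma(X0, Z_1, ..., Z_t); the variable Z_ 0 is not used. *)
Definition natural_filtration (Omega : Type) (dT dZ : measure_display)
    (T : measurableType dT) (Z : measurableType dZ)
    (X0 : Omega -> T) (Z_ : nat -> Omega -> Z) (t : nat) : set (set Omega) :=
  <<s preimage_set_system setT X0 measurable `|`
      \bigcup_(s in [set s | (1 <= s <= t)%N])
        preimage_set_system setT (Z_ s) measurable >>.

(* eta 0 and Z_ 0 are not used. *)
Fixpoint projected_sgd (R : realType) (d : nat) (Z Omega : Type)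
    (B : set 'rV[R]_d) (eta : nat -> R) (G : 'rV[R]_d -> Z -> 'rV[R]_d)
    (theta0 : Omega -> 'rV[R]_d) (Z_ : nat -> Omega -> Z)
    (t : nat) (w : Omega) : 'rV[R]_d :=
  if t is s.+1 then
    let theta := projected_sgd B eta G theta0 Z_ s w in
    proj B (theta - eta s.+1 *: G theta (Z_ s.+1 w))
  else theta0 w.

(* Main.v *)
Require Import Defs.
From mathcomp Require Import all_boot all_order all_algebra.
From mathcomp Require Import all_classical all_reals all_analysis.
From mathcomp Require Import measurable_realfun ring lra.
From HB Require Import structures.

(** The draw Z_(t+1) can be integrated out against P0 with everything known at
    time t frozen, so conditionally on F_t the gradient has mean h(theta_t).
    With D_t = |theta_t - theta_dag|^2, nonexpansiveness of the projection then
    gives E[D_(t+1) | F_t] <= (1 - 2 mu eta_(t+1)) D_t + eta_(t+1)^2.  Since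
    |h| is bounded, the drift condition forces B, hence every D_t, to be
    bounded and thus integrable.  Adding the tails of
    the series of eta_t^2 to D_t produces a bounded nonnegative supermartingale
    S_t; because the sum of eta_(t+1) E[D_t] is finite while that of eta_t is
    not, E[S_t] gets arbitrarily small, and the maximal inequality
    e P(sup_(s >= T) S_s >= e) <= E[S_T] gives S_t -> 0 almost surely. *)

Import Order.TTheory GRing.Theory Num.Theory.
Import numFieldNormedType.Exports.

Local Open Scope classical_set_scope.
Local Open Scope ring_scope.

(** * Euclidean geometry of row vectors *)

Section dot_product.
Context {R : realType} {d : nat}.
Implicit Types u v x : 'rV[R]_d.

Lemma dotC u v : dot u v = dot v u.
Proof. by apply: eq_bigr => i _; rewrite mulrC. Qed.

Lemma dotDl u v x : dot (u + v) x = dot u x + dot v x.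
Proof. by rewrite -big_split; apply: eq_bigr => i _; rewrite mxE mulrDl. Qed.

Lemma dotZl (a : R) u v : dot (a *: u) v = a * dot u v.
Proof. by rewrite mulr_sumr; apply: eq_bigr => i _; rewrite mxE mulrA. Qed.

Lemma dotBl u v x : dot (u - v) x = dot u x - dot v x.
Proof. by rewrite dotDl -scaleN1r dotZl mulN1r. Qed.

Lemma dotZr (a : R) u v : dot u (a *: v) = a * dot u v.
Proof. by rewrite dotC dotZl dotC. Qed.

Lemma dotBr u v x : dot x (u - v) = dot x u - dot x v.
Proof. by rewrite dotC dotBl !(dotC x). Qed.

Lemma dot_ge0 u : 0 <= dot u u.
Proof. by apply: sumr_ge0 => i _; rewrite -expr2 sqr_ge0. Qed.

Lemma sqr_coord_le_dot u i : u ord0 i ^+ 2 <= dot u u.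
Proof.
rewrite /dot (bigD1 i)//= -expr2 lerDl.
by apply: sumr_ge0 => j _; rewrite -expr2 sqr_ge0.
Qed.

Lemma dot_le_coord u (c : R) : (forall i, `|u ord0 i| <= c) ->
  dot u u <= d%:R * c ^+ 2.
Proof.
move=> uc; rewrite -[d in d%:R]card_ord -sumr_const mulr_suml ler_sum// => i _.
by rewrite mul1r -expr2 -real_normK ?num_real// lerXn2r ?nnegrE ?(le_trans _ (uc i)).
Qed.

Lemma sqr_l2norm u : l2norm u ^+ 2 = dot u u.
Proof. by rewrite sqr_sqrtr// dot_ge0. Qed.

Lemma ler_l2norm u v : (l2norm u <= l2norm v) = (dot u u <= dot v v).
Proof. by rewrite ler_sqrt// dot_ge0. Qed.

Lemma coord_norm_le u (i : 'I_d) : `|u ord0 i| <= `|u|.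
Proof.
rewrite [leRHS]/Num.norm/= mx_normrE; apply/bigmax_geP; right => /=.
by exists (ord0, i).
Qed.

Lemma norm_rV_le u (c : R) : 0 <= c -> (forall i, `|u ord0 i| <= c) -> `|u| <= c.
Proof.
move=> c0 uc; rewrite /Num.norm/= mx_normrE; apply/bigmax_leP; split => //= -[i j] _.
by rewrite ord1 uc.
Qed.

(** With [dot_le_norm], this compares the sup norm, in which convergence and boundedness are
    expressed, with the Euclidean norm, in which projection and drift are. *)
Lemma sqr_norm_le_dot u : `|u| ^+ 2 <= dot u u.
Proof.
rewrite -(sqr_sqrtr (dot_ge0 u)) lerXn2r ?nnegrE// ?sqrtr_ge0//.
apply: norm_rV_le => [|i]; first exact: sqrtr_ge0.
by rewrite -sqrtr_sqr ler_sqrt ?dot_ge0// sqr_coord_le_dot.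
Qed.

Lemma dot_le_norm u : dot u u <= d%:R * `|u| ^+ 2.
Proof. by apply: dot_le_coord => i; exact: coord_norm_le. Qed.

Lemma continuous_dist2 x : continuous (fun y : 'rV[R]_d => dot (x - y) (x - y)).
Proof.
have -> : (fun y => dot (x - y) (x - y)) =
    (fun y => \sum_(i < d) (x ord0 i - y ord0 i) * (x ord0 i - y ord0 i)).
  by apply/funext => y; apply: eq_bigr => i _; rewrite !mxE.
elim: (index_enum _) => [|i s IHs] y.
  by under eq_fun do rewrite big_nil; exact: cst_continuous.
under eq_fun do rewrite big_cons.
have c : {for y, continuous (fun z : 'rV[R]_d => x ord0 i - z ord0 i)}.
  by apply: (@cvgB _ _ _ _ (nbhs_filter y)); [exact: cvg_cst|exact: coord_continuous].
by apply: (@cvgD _ _ _ _ (nbhs_filter y)); [exact: (cvgM c c)|exact: IHs].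
Qed.

End dot_product.

(* Otherwise [proj] is the projection of a product topology. *)
Local Notation proj := Defs.proj.

(** * Euclidean projection onto a nonempty closed convex set *)

Section projection.
Context {R : realType} {d : nat}.
Variable B : set 'rV[R]_d.
Hypotheses (B0 : B !=set0) (Bclosed : closed B)
  (Bconvex : convex_set (B : set (convex_lmodType 'rV[R]_d))).

(** Fix b in B. The part K of B no farther from x than b is compact, so the squared distance has a
    minimiser on K, and points of B outside K are farther than b. With existence settled, [getPex]
    excludes the default value of [get]. *)
Lemma proj_spec x : B (proj B x) /\
  forall z, B z -> dot (x - proj B x) (x - proj B x) <= dot (x - z) (x - z).
Proof.
rewrite /proj.
suff [y yP] : exists y, [set y | B y /\
    forall z, B z -> l2norm (x - y) <= l2norm (x - z)] y.
  case: (getPex (ex_intro _ y yP)) => Bp lep; split=> // z Bz.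
  by rewrite -ler_l2norm lep.
have [b Bb] := B0.
pose f y := dot (x - y) (x - y).
pose K := B `&` [set y | f y <= f b].
have Kb : K b by split => /=.
have Kclosed : closed K.
  apply: closedI => //.
  have := @closed_comp _ _ f [set r | r <= f b] (in1W (continuous_dist2 x)).
  by apply; exact: closed_le.
have Kbnd : bounded_set K.
  exists (`|x| + (f b + 1)); split; first exact: num_real.
  move=> M ltM y [_ /= fyb]; apply/ltW/le_lt_trans/ltM.
  rewrite -[y](subKr x) (le_trans (ler_normB _ _))// lerD2l.
  have := le_trans (sqr_norm_le_dot (x - y)) fyb.
  (* From n^2 <= f b it follows that n <= f b + 1: either n <= 1 or n <= n^2. *)
  have [|] := lerP `|x - y| 1; have : 0 <= f b by exact: dot_ge0.
    by lra.
  by move=> ? ?; nra.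
have [|y] := compact_EVT_min (ex_intro _ b Kb)
  (bounded_closed_compact Kbnd Kclosed) (f := f).
  exact/continuous_subspaceT/continuous_dist2.
rewrite inE => -[By fyb] ymin; exists y; split => // z Bz.
rewrite ler_l2norm; have [fz|fz] := lerP (f z) (f b).
  by apply: ymin; rewrite inE; split.
exact: le_trans fyb (ltW fz).
Qed.

Lemma projB x : B (proj B x). Proof. exact: (proj_spec x).1. Qed.

(* Compare proj B x with the points of the segment towards z. *)
Lemma proj_obtuse x z : B z -> dot (x - proj B x) (z - proj B x) <= 0.
Proof.
move=> Bz; set y := proj B x.
have key s : 0 < s -> s < 1 ->
    2 * dot (x - y) (z - y) <= s * dot (z - y) (z - y).
  move=> s0 s1.
  have Bs : B (y + s *: (z - y)).
    have := Bconvex z y (Itv01 (ltW s0) (ltW s1)); rewrite !inE => /(_ Bz (projB x)).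
    congr B; apply/rowP => i; rewrite !mxE/= /unstable.onem; ring.
  have := (proj_spec x).2 _ Bs; rewrite -/y opprD addrA.
  rewrite !(dotBl, dotBr, dotZl, dotZr) => h.
  rewrite -(ler_pM2l s0); move: h; rewrite !(dotC y x) !(dotC z x) !(dotC z y).
  lra.
rewrite leNgt; apply/negP => a0.
set a := dot (x - y) (z - y) in a0 key.
have b0 := dot_ge0 (z - y); set b := dot (z - y) (z - y) in b0 key.
(* For a > 0 this s lies in (0, 1) and s b < a, contradicting 2 a <= s b. *)
have s0 : 0 < a / (a + b + 1) by rewrite divr_gt0//; lra.
have s1 : a / (a + b + 1) < 1 by rewrite ltr_pdivrMr; lra.
have := key _ s0 s1; rewrite mulrAC ler_pdivlMr; nra.
Qed.

Lemma proj_id x : B x -> proj B x = x.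
Proof.
move=> Bx; have := (proj_spec x).2 _ Bx; rewrite subrr [leRHS]/dot.
rewrite (eq_bigr (fun=> 0)) => [|i _]; last by rewrite mxE mul0r.
rewrite big1// => h; have := le_trans (sqr_norm_le_dot _) h.
by rewrite exprn_even_le0//= normr_eq0 subr_eq0 => /eqP.
Qed.

(** Test the obtuse-angle inequality at x against [proj B y] and at y against [proj B x]. Their sum
    makes the cross term of |(p - q) + ((x - p) - (y - q))|^2 = |x - y|^2 nonnegative. *)
Lemma proj_nonexpansive x y :
  dot (proj B x - proj B y) (proj B x - proj B y) <= dot (x - y) (x - y).
Proof.
have h1 := proj_obtuse x _ (projB y); have h2 := proj_obtuse y _ (projB x).
set p := proj B x in h1 h2 *; set q := proj B y in h1 h2 *.
have := dot_ge0 ((x - p) - (y - q)); move: h1 h2.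
rewrite !(dotBl, dotBr) (dotC p x) (dotC q x) (dotC p y) (dotC q y).
rewrite (dotC q p) (dotC y x); lra.
Qed.

Lemma continuous_proj : continuous (proj B).
Proof.
move=> x; apply/(@cvgrPdist_lt _ _ _ _ (nbhs_filter x)) => /= e e0.
(* Going from the sup norm to the Euclidean norm and back costs a factor sqrt d; c dominates it,
   since d <= c^2, and is positive even for d = 0. *)
pose c : R := d%:R + 1; have c1 : 1 <= c by rewrite lerDr.
have : nbhs x [set y | `|x - y| < e / c].
  apply/nbhs_ballP; exists (e / c) => /=; first by rewrite divr_gt0//; lra.
  by move=> y; rewrite -ball_normE.
apply: filterS => y /= xy.
have h := le_trans (le_trans (sqr_norm_le_dot _) (proj_nonexpansive x y))
  (dot_le_norm _).
rewrite -(ltr_pXn2r (ltn0Sn 1)) ?nnegrE ?(ltW e0)//; apply: le_lt_trans h _.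
have cxy : c * `|x - y| < e by rewrite mulrC -ltr_pdivlMr//; lra.
have : 0 <= `|x - y| by [].
have dc : d%:R <= c by rewrite /c; lra.
have d0 : 0 <= d%:R :> R by [].
set n := `|x - y| in cxy * => n0.
apply: (@le_lt_trans _ _ ((c * n) ^+ 2)).
  by rewrite exprMn ler_wpM2r ?sqr_ge0//; nra.
by rewrite ltr_pXn2r// ?nnegrE; [nra|lra].
Qed.

End projection.

(** * Measurability and freezing *)

Section borel_row_vectors.
Context {R : realType} {n : nat}.

(** Sup-norm balls with rational centre and radius: a countable base of the topology. *)
Let box (p : 'rV[rat]_n * rat) : set 'rV[R]_n :=
  [set y | forall i, `|y ord0 i - ratr (p.1 ord0 i)| < ratr p.2].

(** If the ball of radius e at y lies in U, take a rational q < e / 2 and a rational centre within q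
    of y: the box contains y and stays within 2 q < e of it. *)
Lemma open_rat_boxes (U : set 'rV[R]_n) : open U ->
  U = \bigcup_p (if `[< box p `<=` U >] then box p else set0).
Proof.
move=> Uo; apply/seteqP; split=> [y Uy|y [p _]]; last first.
  by case: asboolP => // pU /pU.
have /nbhs_ballP[e /= e0 yeU] : nbhs y U by exact: open_nbhs_nbhs.
have [|q] := @rat_in_itvoo R 0 (e / 2); first by rewrite divr_gt0.
rewrite in_itv/= => /andP[q0 qe].
have /choice[c cP] : forall i, exists r : rat, `|y ord0 i - ratr r| < ratr q.
  move=> i; have [|r] := @rat_in_itvoo R (y ord0 i - ratr q) (y ord0 i + ratr q).
    by lra.
  by rewrite in_itv/= => /andP[h1 h2]; exists r; rewrite ltr_norml; lra.
exists (\row_i c i, q) => //; case: asboolP => [_ i|]; first by rewrite mxE.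
case=> z zbox; apply: yeU; split => // i j; rewrite ord1 -ball_normE/=.
rewrite -(subrKA (ratr (c j))) (le_lt_trans (ler_normD _ _))//.
have := zbox j; rewrite mxE distrC /= => h; have := cP j; lra.
Qed.

(** Open sets are countable unions of boxes, and the preimage of a box is a finite intersection of
    coordinate preimages. *)
Lemma measurable_fun_rV {d} {T : measurableType d} (f : T -> 'rV[R]_n) :
  (forall i, measurable_fun setT (fun t => f t ord0 i)) -> measurable_fun setT f.
Proof.
move=> mf; apply: (measurability (@open 'rV[R]_n)) => // _ [U oU <-].
rewrite setTI (open_rat_boxes _ oU) preimage_bigcup.
apply: countable_bigcupT_measurable => [|p]; first exact: countableP.
case: asboolP => _; last by rewrite preimage_set0.
have -> : f @^-1` box p =
    \bigcap_(i in [set: 'I_n]) ((fun t => f t ord0 i) @^-1`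
      ball (ratr (p.1 ord0 i) : R) (ratr p.2 : R)).
  apply/seteqP; split => t /= h i.
    by move=> _; rewrite -ball_normE/= distrC.
  by have := h i I; rewrite -ball_normE/= distrC.
apply: fin_bigcap_measurable => // i _.
by rewrite -[X in measurable X]setTI; apply: mf => //; exact: measurable_ball.
Qed.

Lemma continuous_measurable_rV (f : 'rV[R]_n -> R) :
  continuous f -> measurable_fun setT f.
Proof.
move=> /continuousP cf; apply: (measurability _ (RGenOpens.measurableE R)).
move=> _ [_ [a [b ->] <-]]; rewrite setTI; apply: sub_sigma_algebra.
exact/cf/interval_open.
Qed.

Lemma measurable_coord (i : 'I_n) :
  measurable_fun setT (fun y : 'rV[R]_n => y ord0 i).
Proof. by apply: continuous_measurable_rV; exact: coord_continuous. Qed.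

End borel_row_vectors.

(** * Integrating out a draw given a sub-sigma-algebra *)

Section freezing.
Context {R : realType} {dO d1 d2 : measure_display} {Omega : measurableType dO}.
Context {T1 : measurableType d1} {T2 : measurableType d2}.
Variables (P : probability Omega R) (F : set (set Omega)).
Variables (X : Omega -> T1) (Y : {RV P >-> T2}) (Q : probability T2 R).
Hypotheses (Fsub : F `<=` measurable) (mX : measurable_wrt F X)
  (YQ : conditional_distribution P F Y Q).

Lemma measurable_wrt_fun : measurable_fun setT X.
Proof. by move=> _ A mA; rewrite setTI; exact/Fsub/mX. Qed.

Lemma joint_law_rect A B : measurable A -> measurable B ->
  P (X @^-1` A `&` Y @^-1` B) = (P (X @^-1` A) * Q B)%E.
Proof.
move=> mA mB; have [_ _ _ /(_ _ (mX _ mA))] := YQ B mB.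
have mXA := Fsub _ (mX _ mA).
have mYB : measurable (Y @^-1` B) by exact: measurable_funPTI.
rewrite integral_indic// setIC => ->.
by rewrite muleC -[in RHS](fineK (fin_num_measure Q B mB)) -integral_cst.
Qed.

(** By [joint_law_rect] and uniqueness of product measures, (X, Y) has law (law of X) x Q; Fubini
    then integrates the second variable first. *)
Lemma freezing (f : T1 * T2 -> R) : measurable_fun setT f ->
  P.-integrable setT (fun w => (f (X w, Y w))%:E) ->
  (\int[P]_w (f (X w, Y w))%:E = \int[P]_w \int[Q]_z (f (X w, z))%:E)%E.
Proof.
move=> mf fi; have mX' := measurable_wrt_fun.
pose XR : {RV P >-> T1} := HB.pack X (isMeasurableFun.Build _ _ _ _ _ mX').
have mXY : measurable_fun setT (fun w => (X w, Y w)).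
  by apply: measurable_fun_pair.
pose XY : {RV P >-> (T1 * T2)%type} :=
  HB.pack (fun w => (X w, Y w)) (isMeasurableFun.Build _ _ _ _ _ mXY).
have mfE : measurable_fun setT (EFin \o f) by exact/measurable_EFinP.
have prodE A : measurable A -> (distribution P XR \x Q)%E A = distribution P XY A.
  apply: product_measure_unique => A' B mA mB /=.
  by rewrite /distribution /pushforward/= -joint_law_rect.
have intXY : (distribution P XY).-integrable setT (EFin \o f).
  by apply: integrable_pushforward.
have intprod : (distribution P XR \x Q)%E.-integrable setT (EFin \o f).
  apply/integrableP; split => //.
  rewrite (eq_measure_integral (distribution P XY)) => [|A mA _]; last exact: prodE.
  by case/integrableP: intXY.
transitivity (\int[distribution P XY]_p (f p)%:E)%E.
  by rewrite integral_pushforward.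
transitivity (\int[distribution P XR \x Q]_p (EFin \o f) p)%E.
  by apply: eq_measure_integral => A mA _; exact/esym/prodE.
rewrite -integral12_prod_meas1// integral_pushforward//.
  exact: (measurable_fubini_F intprod).
(* The inner integral is integrable under the law of X; this is carried back to P. *)
have mG := measurable_fubini_F intprod.
have /integrableP[_ iG] := integrable_fubini_F intprod.
apply/integrableP; split; first exact: measurableT_comp.
rewrite ge0_integral_pushforward// in iG.
exact: measurableT_comp.
Qed.

End freezing.

(** * Integrals of bounded functions *)

Section bounded_functions.
Context {R : realType} {d : measure_display} {T : measurableType d}.
Implicit Types (P : {finite_measure set T -> \bar R}) (f g : T -> R).

Lemma bounded_integrable P f (C : R) : measurable_fun setT f ->
  (forall x, `|f x| <= C) -> P.-integrable setT (EFin \o f).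
Proof.
move=> mf fC; apply: measurable_bounded_integrable => //.
  by rewrite -ge0_fin_numE// fin_num_measure.
exists C; split; first exact: num_real.
by move=> M CM x _; exact: le_trans (fC x) (ltW CM).
Qed.

Lemma norm_indic_le1 (A : set T) x : `|\1_A x : R| <= 1.
Proof. by rewrite indicE; case: (_ \in _); rewrite ?normr1 ?normr0. Qed.

Lemma integrable_indicM P (A : set T) f (C : R) : measurable A ->
  measurable_fun setT f -> (forall x, `|f x| <= C) ->
  P.-integrable setT (EFin \o (fun x => \1_A x * f x)).
Proof.
move=> mA mf fC; apply: (bounded_integrable _ _ C) => [|x].
  by apply: measurable_funM => //; exact: measurable_indic.
by rewrite normrM -[C]mul1r ler_pM// norm_indic_le1.
Qed.

Lemma norm_Rintegral_le (P : probability T R) f (C : R) : measurable_fun setT f ->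
  (forall x, `|f x| <= C) -> `|\int[P]_x f x| <= C.
Proof.
move=> mf fC; have fi := bounded_integrable P _ _ mf fC.
apply: le_trans (le_normr_Rintegral _ fi) _ => //.
have -> : C = \int[P]_(x in setT) C.
  by rewrite Rintegral_cst// [X in fine X](probability_setT P) mulr1.
apply: le_Rintegral => //; first exact: integrable_norm.
by apply: (bounded_integrable _ _ `|C|).
Qed.

End bounded_functions.

(** * Averaging a bounded function of two variables over the second one *)

Section average.
Context {R : realType} {d1 d2 : measure_display}.
Context {T1 : measurableType d1} {T2 : measurableType d2}.
Variables (Q : probability T2 R) (g : T1 -> T2 -> R) (C : R).
Hypotheses (mg : measurable_fun setT (fun p : T1 * T2 => g p.1 p.2))
  (gC : forall x z, `|g x z| <= C).

Lemma measurable_section x : measurable_fun setT (g x).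
Proof. exact: measurableT_comp mg (pair1_measurable x). Qed.

Lemma integrable_section x : Q.-integrable setT (EFin \o g x).
Proof. exact: bounded_integrable (measurable_section x) (gC x). Qed.

Lemma expectation_section x : 'E_Q[g x]%E = (\int[Q]_z g x z)%:E.
Proof.
rewrite unlock /Rintegral fineK//.
by apply: integrable_fin_num => //; exact: integrable_section.
Qed.

Lemma norm_average_le x : `|fine 'E_Q[g x]| <= C.
Proof.
rewrite expectation_section/=.
exact: norm_Rintegral_le (measurable_section x) (gC x).
Qed.

Lemma measurable_average : measurable_fun setT (fun x => fine 'E_Q[g x]%E).
Proof.
apply: measurableT_comp => //.
have mE : measurable_fun setT (EFin \o (fun p : T1 * T2 => g p.1 p.2)).
  exact/measurable_EFinP.
(* Fubini's theorem needs some measure on T1; a Dirac mass will do. *)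
have gi : (dirac (point : T1) \x Q)%E.-integrable setT
    (EFin \o (fun p : T1 * T2 => g p.1 p.2)).
  apply: measurable_bounded_integrable => //.
    rewrite -setXTT [X in (X < _)%E]product_measure1E// lte_mul_pinfty//.
    by rewrite -ge0_fin_numE//; exact: fin_num_measure.
  exists C; split; first exact: num_real.
  by move=> M CM p _; exact: le_trans (gC _ _) (ltW CM).
have := measurable_fubini_F gi; congr measurable_fun.
by apply/funext => x; rewrite unlock.
Qed.

End average.

(** * Conditional means of functions of a known variable and a fresh draw *)

Section sub_sigma_algebra.
Context {R : realType} {dO : measure_display} {Omega : measurableType dO}.
Variables (P : probability Omega R) (S : set (set Omega)).

(** Changing the type of the source makes the closure lemmas for measurable functions available for
    a sub-sigma-algebra. *)
Lemma measurable_wrtP {d} {T : measurableType d} (X : Omega -> T) :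
  measurable_wrt <<s S >> X <->
  measurable_fun (setT : set (g_sigma_algebraType S)) X.
Proof.
split=> [mX _ A mA|mX A mA]; first by rewrite setTI; exact: mX.
by rewrite -[X @^-1` A]setTI; exact: mX.
Qed.

Hypothesis Ssub : <<s S >> `<=` measurable.

Context {d1 d2 : measure_display}.
Context {T1 : measurableType d1} {T2 : measurableType d2}.
Variables (X : Omega -> T1) (Y : {RV P >-> T2}) (Q : probability T2 R).
Hypotheses (mX : measurable_wrt <<s S >> X)
  (YQ : conditional_distribution P <<s S >> Y Q).
Variables (g : T1 -> T2 -> R) (C : R).
Hypotheses (mg : measurable_fun setT (fun p : T1 * T2 => g p.1 p.2))
  (gC : forall x z, `|g x z| <= C).

Lemma measurable_frozen : measurable_fun setT (fun w => g (X w) (Y w)).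
Proof.
have mXY : measurable_fun setT (fun w => (X w, Y w)).
  by apply: measurable_fun_pair => //; exact: measurable_wrt_fun mX.
exact: measurableT_comp mg mXY.
Qed.

Lemma freezing_weighted (U : Omega -> R) (K : R) :
  measurable_wrt <<s S >> U -> (forall w, `|U w| <= K) ->
  \int[P]_w (U w * g (X w) (Y w)) = \int[P]_w (U w * fine 'E_Q[g (X w)]).
Proof.
move=> mU UK.
have mUX : measurable_wrt <<s S >> (fun w => (U w, X w)).
  by apply/measurable_wrtP/measurable_fun_pair; exact/measurable_wrtP.
pose f (p : (R * T1) * T2) := p.1.1 * g p.1.2 p.2.
have mf : measurable_fun setT f.
  apply: measurable_funM.
    exact: (measurableT_comp measurable_fst measurable_fst).
  have m2 : measurable_fun setT (fun p : (R * T1) * T2 => (p.1.2, p.2)).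
    apply: measurable_fun_pair => //.
    exact: (measurableT_comp measurable_snd measurable_fst).
  exact: measurableT_comp mg m2.
have fi : P.-integrable setT (fun w => (f ((U w, X w), Y w))%:E).
  apply: (bounded_integrable _ (fun w => U w * g (X w) (Y w)) (K * C)).
    by apply: measurable_funM measurable_frozen; exact: measurable_wrt_fun mU.
  by move=> w; rewrite normrM ler_pM.
have := freezing _ _ _ _ _ Ssub mUX YQ f mf fi.
rewrite /Rintegral => ->; congr fine; apply: eq_integral => w _.
rewrite (expectation_section _ _ _ mg gC)/= /f/=.
rewrite -RintegralZl//; last exact: integrable_section mg gC _.
rewrite /Rintegral fineK//; apply: integrable_fin_num => //.
apply: (bounded_integrable _ (fun z => U w * g (X w) z) (K * C)).
  by apply: measurable_funM => //; exact: measurable_section mg _.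
by move=> z; rewrite normrM ler_pM.
Qed.

(** Indicators of events of the sub-sigma-algebra are admissible weights in [freezing_weighted]. *)
Lemma centered_condexp :
  is_condexp P <<s S >> (fun w => g (X w) (Y w) - fine 'E_Q[g (X w)]) (cst 0).
Proof.
have i1 := bounded_integrable P _ _ measurable_frozen (fun w => gC (X w) (Y w)).
have mH : measurable_fun setT (fun w => fine 'E_Q[g (X w)]).
  apply: (measurableT_comp (measurable_average Q _ _ mg gC)).
  exact: measurable_wrt_fun mX.
have i2 := bounded_integrable P _ _ mH (fun w => norm_average_le Q _ _ mg gC (X w)).
have i3 : P.-integrable setT
    (EFin \o (fun w => g (X w) (Y w) - fine 'E_Q[g (X w)])).
  by have := integrableB measurableT i1 i2.
split => //.
- by apply: (bounded_integrable _ _ 0) => // w; rewrite normr0.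
- by apply/measurable_wrtP; exact: measurable_cst.
move=> A FA; rewrite integral0 integral_mkcond.
have mA := Ssub _ FA.
have mI : measurable_wrt <<s S >> (\1_A : Omega -> R).
  by apply/measurable_wrtP; exact: measurable_indic.
have := freezing_weighted _ _ mI (norm_indic_le1 A).
move/eqP; rewrite -subr_eq0 -RintegralB//; last 2 first.
- exact: (integrable_indicM _ _ _ C mA measurable_frozen).
- by apply: (integrable_indicM _ _ _ C mA mH) => w; exact: norm_average_le mg gC _.
move=> /eqP E.
have {E} : \int[P]_w ((g (X w) (Y w) - fine 'E_Q[g (X w)]) * \1_A w) = 0.
  by rewrite -[RHS]E; apply: eq_Rintegral => w _; rewrite -mulrBr mulrC.
(* [fine] also sends infinite values to 0, so the integral must be shown finite before the
   extended-real equality can be recovered. *)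
rewrite /Rintegral => /eqP; rewrite fine_eq0; last first.
  apply: integrable_fin_num => //.
  under eq_fun do rewrite mulrC.
  apply: (integrable_indicM _ _ _ (C + C)) => // [|w].
    by apply: measurable_funB => //; exact: measurable_frozen.
  by rewrite (le_trans (ler_normB _ _))// lerD// norm_average_le.
move=> /eqP E; rewrite -[RHS]E; apply: eq_integral => w _.
by rewrite /patch indicE; case: ifPn; rewrite ?mulr1 ?mulr0.
Qed.

End sub_sigma_algebra.

(** * Nonnegative supermartingales *)

Section supermartingale.
Context {R : realType} {dO : measure_display} {Omega : measurableType dO}.
Variables (P : probability Omega R) (gen : nat -> set (set Omega)).
Let F t := <<s gen t >>.
Hypotheses (Fsub : forall t, F t `<=` measurable)
  (Fmono : forall s t, (s <= t)%N -> F s `<=` F t).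
Variables (S : nat -> Omega -> R) (C : R).
Hypotheses (mS : forall t, measurable_wrt (F t) (S t))
  (S0 : forall t w, 0 <= S t w) (SC : forall t w, S t w <= C)
  (Ssuper : forall t A, F t A ->
    \int[P]_w (\1_A w * S t.+1 w) <= \int[P]_w (\1_A w * S t w)).

(** The event that the first time from T on with S >= e is at least T + k. It is everything for k =
    0, and for k + 1 it is decided at time T + k. *)
Let below e T k : set Omega :=
  \bigcap_(j in [set j | (j < k)%N]) [set w | S (T + j)%N w < e].

Let F_below e T k : F (T + k)%N (below e T k.+1).
Proof.
have -> : below e T k.+1 = \big[setI/setT]_(j < k.+1) [set w | S (T + j)%N w < e].
  by rewrite -(bigcap_mkord _ (fun j => [set w | S (T + j)%N w < e])).
apply: (@bigsetI_measurable _ (g_sigma_algebraType (gen (T + k)%N))) => j _.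
have jk : (T + j <= T + k)%N by rewrite leq_add2l -ltnS.
change (F (T + k)%N [set w | S (T + j)%N w < e]); apply: (Fmono _ _ jk).
have := mS (T + j)%N `]-oo, e[%classic (measurable_itv _).
by congr (F _ _); apply/seteqP; split => w /=; rewrite in_itv.
Qed.

Let measurable_below e T k : measurable (below e T k).
Proof.
case: k => [|k]; last exact: Fsub (F_below e T k).
by rewrite (_ : below e T 0 = setT)//; apply/seteqP; split.
Qed.

Let measurable_S t : measurable_fun setT (S t).
Proof. exact: measurable_wrt_fun (Fsub _) (mS t). Qed.

(* The left-hand side dominates the expectation of S stopped at its first passage
   above e and replaced there by e. *)
Let stopped_le (e : R) T k : 0 <= e ->
  \int[P]_w (\1_(below e T k) w * S (T + k)%N w) +
    \int[P]_w (\1_(~` below e T k) w * e) <= \int[P]_w S T w.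
Proof.
move=> e0.
have iS A t : measurable A ->
    P.-integrable setT (EFin \o (fun w => \1_A w * S t w)).
  by move=> mA; apply: (integrable_indicM _ _ _ C) => // w; rewrite ger0_norm.
have ie A : measurable A -> P.-integrable setT (EFin \o (fun w => \1_A w * e)).
  by move=> mA; apply: (integrable_indicM _ _ (cst e) e) => // w; rewrite ger0_norm.
have mB := measurable_below e T; have mBC k' := measurableC (mB k').
elim: k => [|k IHk].
  have -> : below e T 0 = setT by apply/seteqP; split.
  rewrite addn0 setCT; under eq_Rintegral do rewrite indicT mul1r.
  under [X in _ + X]eq_Rintegral do rewrite indic0 mul0r.
  by rewrite Rintegral_cst// mul0r addr0.
apply: le_trans IHk; rewrite addnS.
(* The event [below e T k.+1] is known at time T + k, so the supermartingale inequality over it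
   moves S back one step. *)
apply: (@le_trans _ _ (\int[P]_w (\1_(below e T k.+1) w * S (T + k)%N w) +
    \int[P]_w (\1_(~` below e T k.+1) w * e))).
  by rewrite lerD2r; apply: Ssuper; exact: F_below.
rewrite -!RintegralD//; last 4 first.
- exact: iS.
- exact: ie.
- exact: iS.
- exact: ie.
apply: le_Rintegral => //.
- by have := integrableD measurableT (iS _ (T + k)%N (mB k.+1)) (ie _ (mBC k.+1)).
- by have := integrableD measurableT (iS _ (T + k)%N (mB k)) (ie _ (mBC k)).
(* The integrands differ only where the passage occurs exactly at time T + k; there e replaces a
   value S (T + k) >= e. *)
move=> w _; rewrite !indicE !in_setC.
have [wk1|wk1] := boolP (w \in below e T k.+1).
  have -> : w \in below e T k.
    move: wk1; rewrite !inE => wk1 j /= jk; apply: wk1 => /=.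
    exact: ltn_trans jk _.
  by rewrite !mul1r !mul0r.
have [wk|wk] /= := boolP (w \in below e T k).
  rewrite !mul0r !mul1r add0r addr0 leNgt; apply: contra wk1 => Sk.
  move: wk; rewrite !inE => wk j /=; rewrite ltnS leq_eqVlt => /orP[/eqP->//|].
  exact: wk.
by rewrite !mul0r !mul1r.
Qed.

(** The complements of [below e T k] increase to the passage event, so continuity from below reduces
    the bound to [stopped_le] with its nonnegative first term dropped. *)
Lemma maximal_inequality (e : R) T : 0 < e ->
  (P (\bigcup_k [set w | (e <= S (T + k)%N w)%R]) <=
    (e^-1 * \int[P]_w S T w)%:E)%E.
Proof.
move=> e0; have mBC k := measurableC (measurable_below e T k).
have -> : \bigcup_k [set w | e <= S (T + k)%N w] = \bigcup_k ~` below e T k.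
  apply/seteqP; split => w [k _ /= h].
    by exists k.+1 => // /(_ k (ltnSn k))/=; rewrite ltNge h.
  move/existsNP : h => [j /not_implyP[_ /negP]]; rewrite -leNgt => h.
  by exists j.
have mU : measurable (\bigcup_k ~` below e T k) by exact: bigcupT_measurable.
have ndB : nondecreasing_seq (fun k => ~` below e T k).
  move=> m k mk; apply/subsetPset/subsetC => w h j /= jm; apply: h => /=.
  exact: leq_trans jm mk.
have cB := nondecreasing_cvg_mu (mu := P) mBC mU ndB.
rewrite -(cvg_lim _ cB)//; apply: lime_le; first by apply/cvg_ex; eexists; exact: cB.
apply: nearW => k /=.
rewrite -[leLHS](fineK (fin_num_measure P _ (mBC k))) lee_fin ler_pdivlMl//.
apply: le_trans (stopped_le _ T k (ltW e0)).
have -> : \int[P]_w (\1_(~` below e T k) w * e) = e * fine (P (~` below e T k)).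
  rewrite RintegralZr//; last exact: integrable_indic.
  by rewrite mulrC /Rintegral integral_indic// setIT.
by rewrite lerDr; apply: Rintegral_ge0 => w _; rewrite mulr_ge0.
Qed.

(** If S does not tend to 0 then, for some m, it reaches 1/(m+1) after every time T. The maximal
    inequality bounds the probability of this by (m+1) E[S_T] for each T, hence by any e > 0. *)
Lemma supermartingale_cvg0 :
  (forall e, 0 < e -> exists T, \int[P]_w S T w < e) ->
  {ae P, forall w, S t w @[t --> \oo] --> (0 : R)}.
Proof.
move=> ES.
pose bad (m T : nat) := \bigcup_k [set w | m.+1%:R^-1 <= S (T + k)%N w].
have mbad m T : measurable (bad m T).
  apply: bigcupT_measurable => k.
  have := measurable_S (T + k)%N measurableT `[m.+1%:R^-1, +oo[%classic
    (measurable_itv _).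
  by rewrite setTI; congr measurable; apply/seteqP; split => w /=; rewrite in_itv/= andbT.
suff : P.-negligible (\bigcup_m \bigcap_T bad m T).
  apply: negligibleS => w /= Sw; apply: contrapT => nbad; apply: Sw.
  apply/cvgrPdist_lt => /= e e0.
  have [m me] : exists m : nat, m.+1%:R^-1 < e.
    by have [m _ /(_ _ (leqnn m))] := near_infty_natSinv_lt (PosNum e0); exists m.
  have /existsNP[T /not_implyP[_ nb]] : ~ (\bigcap_T bad m T) w.
    by move=> h; apply: nbad; exists m.
  exists T => // t /= Tt; rewrite sub0r normrN ger0_norm//.
  apply: lt_trans me; rewrite ltNge; apply/negP => h; apply: nb.
  by exists (t - T)%N => //=; rewrite subnKC.
apply: negligible_bigcup => m.
have mI : measurable (\bigcap_T bad m T) by exact: bigcapT_measurable.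
apply/negligibleP => //; apply/eqP; rewrite eq_le measure_ge0 andbT.
apply/lee_addgt0Pr => e e0; rewrite add0e.
have m0 : 0 < m.+1%:R^-1 :> R by rewrite invr_gt0.
have [T ET] := ES _ (mulr_gt0 m0 e0).
apply: (@le_trans _ _ (P (bad m T))).
  by apply: le_measure; rewrite ?inE// => w h; exact: h.
apply: le_trans (maximal_inequality _ T m0) _.
by rewrite lee_fin ler_pdivrMl// ltW.
Qed.

End supermartingale.

(** * Divergent step sizes and tails of convergent series *)

Lemma summable_decrease_small {R : realType} (a b eta : nat -> R) :
  (forall t, 0 <= a t) -> (forall t, 0 <= b t) ->
  (forall t, 0 < eta t.+1) ->
  (\sum_(1 <= t <oo) (eta t)%:E = +oo)%E ->
  (forall t, b t.+1 + eta t.+1 * a t <= b t) ->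
  forall e N, 0 < e -> exists2 T, (N <= T)%N & a T < e.
Proof.
move=> a0 b0 eta0 sumoo decr e N e0; apply: contrapT => noT.
have big T : (N <= T)%N -> e <= a T.
  by move=> NT; rewrite leNgt; apply/negP => aT; apply: noT; exists T.
(* If a stays at least e from N on, telescoping the decrease of b bounds the sum of the step sizes
   after N by b N / e. *)
have sum_le n : b (N + n)%N + e * (\sum_(N <= t < N + n) eta t.+1) <= b N.
  elim: n => [|n IHn]; first by rewrite addn0 big_geq// mulr0 addr0.
  apply: le_trans IHn; rewrite addnS big_nat_recr ?leq_addr//= mulrDr.
  have := decr (N + n)%N; have := big (N + n)%N (leq_addr _ _).
  have := eta0 (N + n)%N; nra.
have fin n : \sum_(1 <= t < n.+1) eta t <= \sum_(1 <= t < N.+1) eta t + b N / e.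
  have [nN|Nn] := leqP n N.
    rewrite (@big_cat_nat _ _ _ n.+1 1 N.+1)//= -addrA lerDl addr_ge0//.
      by rewrite big_nat; apply: sumr_ge0 => -[|t]// /andP[]// *; exact: ltW.
    by rewrite divr_ge0// ltW.
  rewrite (@big_cat_nat _ _ _ N.+1 1 n.+1)//= ?ltnS ?(ltnW Nn)// lerD2l ler_pdivlMr//.
  have := sum_le (n - N)%N; rewrite subnKC ?(ltnW Nn)// => h.
  rewrite big_add1/= mulrC; apply: le_trans h; rewrite lerDr//.
have : (\sum_(1 <= t <oo) (eta t)%:E <=
    (\sum_(1 <= t < N.+1) eta t + b N / e)%:E)%E.
  apply: lime_le.
    by apply: is_cvg_nneseries => -[|n]// _ _; rewrite lee_fin ltW.
  near=> n; have n0 : (0 < n)%N by near: n; exists 1%N.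
  by rewrite sumEFin lee_fin -(prednK n0) fin.
by rewrite sumoo leye_eq.
Unshelve. all: by end_near. Qed.

(** The sequence r t is the sum of u over indices above t. The recursion is what lets it absorb the
    noise term of one descent step. *)
Lemma series_tail {R : realType} (u : nat -> R) : (forall t, 0 <= u t) ->
  (\sum_(1 <= t <oo) (u t)%:E < +oo)%E ->
  exists r : nat -> R, [/\ forall t, 0 <= r t, forall t, r t = r t.+1 + u t.+1 &
    r t @[t --> \oo] --> (0 : R)].
Proof.
move=> u0 sfin.
pose s n := \sum_(1 <= t < n) u t; pose q := fine (\sum_(1 <= t <oo) (u t)%:E)%E.
have s_cvg : s n @[n --> \oo] --> q.
  have : (\sum_(1 <= t < n) (u t)%:E)%E @[n --> \oo] -->
      (\sum_(1 <= t <oo) (u t)%:E)%E.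
    by apply: is_cvg_nneseries => n _ _; rewrite lee_fin.
  rewrite -[X in _ --> X]fineK; last first.
    by rewrite ge0_fin_numE//; apply: nneseries_ge0 => n _ _; rewrite lee_fin.
  rewrite (_ : s = fine \o (fun n => (\sum_(1 <= t < n) (u t)%:E)%E)).
    exact: fine_cvg.
  by apply/funext => n /=; rewrite sumEFin.
have s_nd : nondecreasing_seq s.
  apply/nondecreasing_seqP => -[|n]; first by rewrite /s !big_geq.
  by rewrite /s [leRHS]big_nat_recr//= lerDl.
(* The partial sum [s n] stops before n, hence the successor. *)
exists (fun t => q - s t.+1); split.
- move=> t; rewrite subr_ge0 -(cvg_lim _ s_cvg)//.
  by apply: nondecreasing_cvgn_le => //; apply/cvg_ex; exists q.
- by move=> t; rewrite /s [X in _ = _ - X + _]big_nat_recr//=; ring.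
- rewrite -(subrr q); apply: cvgB; first exact: cvg_cst.
  by rewrite (cvg_shiftS s).
Qed.

(** * Finite sums under the real-valued integral *)

Section Rintegral_sum.
Context {R : realType} {d : measure_display} {T : measurableType d} {I : Type}.
Variables (mu : {measure set T -> \bar R}) (f : I -> T -> R).
Hypothesis fi : forall i, mu.-integrable setT (EFin \o f i).

Lemma integrable_sum_EFin (s : seq I) :
  mu.-integrable setT (EFin \o (fun x => \sum_(i <- s) f i x)).
Proof.
elim: s => [|i s IHs].
  rewrite (_ : _ \o _ = cst 0%E); first exact: integrable0.
  by apply/funext => x /=; rewrite big_nil.
have := integrableD measurableT (fi i) IHs.
by congr integrable; apply/funext => x /=; rewrite big_cons.
Qed.

Lemma Rintegral_sum (s : seq I) :
  \int[mu]_x (\sum_(i <- s) f i x) = \sum_(i <- s) \int[mu]_x f i x.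
Proof.
elim: s => [|i s IHs].
  rewrite big_nil; under eq_Rintegral do rewrite big_nil.
  by rewrite Rintegral_cst// mul0r.
rewrite big_cons; under eq_Rintegral do rewrite big_cons.
by rewrite RintegralD// ?IHs//; exact: integrable_sum_EFin.
Qed.

End Rintegral_sum.

(** * Projected stochastic gradient descent *)

Section natural_filtration.
Context {R : realType} {dO dT dZ : measure_display}.
Context {Omega : measurableType dO} {T : measurableType dT} {Z : measurableType dZ}.
Variables (P : probability Omega R) (X0 : {RV P >-> T}) (Z_ : nat -> {RV P >-> Z}).

(** [natural_filtration] unfolds to the sigma-algebra generated by this family; naming the
    generators puts it in the form required by [measurable_wrtP]. *)
Definition filtration_generator t : set (set Omega) :=
  preimage_set_system setT X0 measurable `|`
    \bigcup_(s in [set s | (1 <= s <= t)%N])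
      preimage_set_system setT (Z_ s) measurable.

Lemma filtration_sub t : <<s filtration_generator t >> `<=` measurable.
Proof.
apply: smallest_sub; first exact: sigma_algebra_measurable.
move=> A [[B mB <-]|[s _ [B mB <-]]]; exact: measurable_funP.
Qed.

Lemma filtration_mono s t : (s <= t)%N ->
  <<s filtration_generator s >> `<=` <<s filtration_generator t >>.
Proof.
move=> st; apply: sub_sigma_algebra2 => A [X0A|[k /= /andP[k1 ks] ZA]].
  by left.
by right; exists k => //=; rewrite k1 (leq_trans ks).
Qed.

Lemma measurable_wrt_init t : measurable_wrt <<s filtration_generator t >> X0.
Proof.
by move=> A mA; apply: sub_sigma_algebra; left; exists A; rewrite ?setTI.
Qed.

Lemma measurable_wrt_draw t : measurable_wrt <<s filtration_generator t.+1 >> (Z_ t.+1).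
Proof.
move=> A mA; apply: sub_sigma_algebra; right.
by exists t.+1; rewrite /= ?ltnSn//; exists A; rewrite ?setTI.
Qed.

End natural_filtration.

(** * Martingale differences and convergence of the iterates *)

Section projected_sgd.
Context {R : realType} {d : nat} {dO dZ : measure_display}.
Context {Omega : measurableType dO} {Z : measurableType dZ}.
Variables (P : probability Omega R) (P0 : probability Z R).
Variables (G : 'rV[R]_d -> Z -> 'rV[R]_d).
Hypotheses (mG : measurable_fun setT (fun p : 'rV[R]_d * Z => G p.1 p.2))
  (G1 : forall x z, l2norm (G x z) <= 1).
Variables (theta0 : {RV P >-> 'rV[R]_d}) (Z_ : nat -> {RV P >-> Z}).
Let gen := filtration_generator P theta0 Z_.
Hypothesis condZ : forall t, conditional_distribution P <<s gen t >> (Z_ t.+1) P0.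
Variable B : set 'rV[R]_d.
Hypotheses (B0 : B !=set0) (Bclosed : closed B)
  (Bconvex : convex_set (B : set (convex_lmodType 'rV[R]_d))).
Variable eta : nat -> R.
Let theta := projected_sgd B eta G theta0 Z_.
Let h := mean_field P0 G.

Let g (i : 'I_d) x z := G x z ord0 i.

Let mg i : measurable_fun setT (fun p : 'rV[R]_d * Z => g i p.1 p.2).
Proof. exact: measurableT_comp (measurable_coord i) mG. Qed.

Let dotG x z : dot (G x z) (G x z) <= 1.
Proof. by rewrite -sqr_l2norm expr_le1// sqrtr_ge0. Qed.

Let g1 i x z : `|g i x z| <= 1.
Proof.
rewrite -(expr_le1 (n := 2))// real_normK ?num_real//.
exact: le_trans (sqr_coord_le_dot _ i) (dotG x z).
Qed.

Let hE x i : h x ord0 i = fine 'E_P0[g i x]%E.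
Proof. by rewrite mxE. Qed.

Let h1 x i : `|h x ord0 i| <= 1.
Proof. by rewrite hE; exact: norm_average_le (mg i) (g1 i) x. Qed.

Let mh : measurable_fun setT h.
Proof.
apply: measurable_fun_rV => i; under eq_fun do rewrite hE.
exact: measurable_average (mg i) (g1 i).
Qed.

Let mproj : measurable_fun setT (proj B).
Proof.
apply: measurable_fun_rV => i; apply: continuous_measurable_rV => x.
apply: (@continuous_comp _ _ _ (proj B) (fun y => y ord0 i)).
  exact: continuous_proj.
exact: coord_continuous.
Qed.

Let measurable_subrV {d'} {T : measurableType d'} (X Y : T -> 'rV[R]_d) (a : R) :
  measurable_fun setT X -> measurable_fun setT Y ->
  measurable_fun setT (fun w => X w - a *: Y w).
Proof.
move=> mX mY; apply: measurable_fun_rV => i.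
under eq_fun do rewrite !mxE.
apply: measurable_funB.
  exact: measurableT_comp (measurable_coord i) mX.
apply: measurable_funM => //.
exact: measurableT_comp (measurable_coord i) mY.
Qed.

Lemma measurable_wrt_mono {dT} {T : measurableType dT} s t (X : Omega -> T) :
  (s <= t)%N -> measurable_wrt <<s gen s >> X -> measurable_wrt <<s gen t >> X.
Proof. by move=> st mX A mA; apply: filtration_mono st _ _; exact: mX. Qed.

Lemma measurable_wrt_gradient t : measurable_wrt <<s gen t >> (theta t) ->
  measurable_wrt <<s gen t.+1 >> (fun w => G (theta t w) (Z_ t.+1 w)).
Proof.
move=> /(measurable_wrt_mono _ _ _ (leqnSn t))/measurable_wrtP mt.
have mZ := (measurable_wrtP _ _).1 (measurable_wrt_draw P theta0 Z_ t).
apply/measurable_wrtP; exact: measurableT_comp mG (measurable_fun_pair mt mZ).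
Qed.

Lemma measurable_wrt_iterate t : measurable_wrt <<s gen t >> (theta t).
Proof.
elim: t => [|t IHt]; first exact: measurable_wrt_init.
apply/measurable_wrtP; apply: (measurableT_comp mproj).
apply: measurable_subrV.
  by apply/measurable_wrtP; exact: measurable_wrt_mono IHt.
by apply/measurable_wrtP; exact: measurable_wrt_gradient.
Qed.

(** The iterate is known at time t and the next draw has conditional law P0, so [centered_condexp]
    applies to each coordinate of G, which is bounded by 1. *)
Lemma sgd_martingale_difference :
  martingale_difference P (natural_filtration theta0 Z_)
    (fun t w => G (theta t w) (Z_ t.+1 w) - h (theta t w)).
Proof.
move=> t.
have C i : is_condexp P <<s gen t >>
    (fun w => (G (theta t w) (Z_ t.+1 w) - h (theta t w)) ord0 i) (cst 0).
  have := centered_condexp _ _ (@filtration_sub _ _ _ _ _ _ _ P theta0 Z_ t) _ _ _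
    (measurable_wrt_iterate t) (condZ t) _ _ (mg i) (g1 i).
  by congr is_condexp; apply/funext => w; rewrite !mxE.
split => //; first by move=> i; have [] := C i.
(* The factor 1 gives the shape expected by [measurable_subrV]. *)
have -> : (fun w => G (theta t w) (Z_ t.+1 w) - h (theta t w)) =
    (fun w => G (theta t w) (Z_ t.+1 w) - 1 *: h (theta t w)).
  by apply/funext => w; rewrite scale1r.
apply/measurable_wrtP.
apply: measurable_subrV.
  by apply/measurable_wrtP; apply: measurable_wrt_gradient; exact: measurable_wrt_iterate.
apply: (measurableT_comp mh); apply/measurable_wrtP.
exact: measurable_wrt_mono (leqnSn t) (measurable_wrt_iterate t).
Qed.

Variables (theta_dag : 'rV[R]_d) (mu : R).
Hypotheses (dagB : B theta_dag) (mu0 : 0 < mu)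
  (drift : forall x, B x ->
    mu * l2norm (x - theta_dag) ^+ 2 <= dot (x - theta_dag) (h x))
  (theta0B : forall w, B (theta0 w)) (eta0 : forall t, 0 < eta t.+1).

Let D t w := dot (theta t w - theta_dag) (theta t w - theta_dag).

Lemma iterate_in t w : B (theta t w).
Proof. by case: t => [|t]; [exact: theta0B|exact: projB]. Qed.

(** The drift is quadratic in the distance while h is bounded, so B is bounded. The factor d comes
    from bounding each coordinate of h by 1. *)
Lemma dist2_le x : B x ->
  dot (x - theta_dag) (x - theta_dag) <= d%:R / mu ^+ 2.
Proof.
move=> Bx; have := drift _ Bx; rewrite sqr_l2norm.
move: (x - theta_dag) => v dr.
(* 2 mu <v, h x> <= mu^2 |v|^2 + |h x|^2 *)
have hd : dot (h x) (h x) <= d%:R.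
  by have := dot_le_coord _ _ (h1 x); rewrite expr1n mulr1.
have := dot_ge0 (mu *: v - h x); rewrite !(dotBl, dotBr, dotZl, dotZr) (dotC (h x) v).
rewrite ler_pdivlMr ?exprn_gt0// expr2 => sq.
have := ler_wpM2l (ltW mu0) dr; lra.
Qed.

(** Since [theta_dag] is its own projection, nonexpansiveness removes [proj B] from both sides;
    expand the square and use |G| <= 1. *)
Lemma dist2_step t w : D t.+1 w <= D t w -
  2 * eta t.+1 * dot (theta t w - theta_dag) (G (theta t w) (Z_ t.+1 w)) +
  eta t.+1 ^+ 2.
Proof.
rewrite /D /= -[X in _ - X](proj_id _ B0 Bclosed _ dagB) -/(theta t w).
apply: le_trans (proj_nonexpansive _ B0 Bclosed Bconvex _ _) _.
rewrite addrAC !(dotBl _ (_ *: _)) !(dotBr _ (_ *: _)) !(dotZl, dotZr).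
rewrite (dotC (G _ _)); have := dotG (theta t w) (Z_ t.+1 w).
have := eta0 t; nra.
Qed.

Let measurable_D t : measurable_wrt <<s gen t >> (D t).
Proof.
have mt : measurable_fun setT (theta t : g_sigma_algebraType (gen t) -> _).
  by apply/measurable_wrtP; exact: measurable_wrt_iterate.
apply/measurable_wrtP.
have mv i : measurable_fun setT
    (fun w : g_sigma_algebraType (gen t) => (theta t w - theta_dag) ord0 i).
  under eq_fun do rewrite !mxE.
  by apply: measurable_funB => //; exact: measurableT_comp (measurable_coord i) mt.
by apply: measurable_sum => i; apply: measurable_funM.
Qed.

Let D0 t w : 0 <= D t w. Proof. exact: dot_ge0. Qed.

Let DK t w : D t w <= d%:R / mu ^+ 2. Proof. exact/dist2_le/iterate_in. Qed.

Let Fsub t := @filtration_sub _ _ _ _ _ _ _ P theta0 Z_ t.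

Let integrable_D (A : set Omega) t : measurable A ->
  P.-integrable setT (EFin \o (fun w => \1_A w * D t w)).
Proof.
move=> mA; apply: (integrable_indicM _ _ _ (d%:R / mu ^+ 2)) => //.
  exact: measurable_wrt_fun (Fsub t) (measurable_D t).
by move=> w; rewrite ger0_norm.
Qed.

(** This is the conditional one-step inequality, integrated over an event A known at time t. *)
Lemma expected_dist2_step t (A : set Omega) : <<s gen t >> A ->
  \int[P]_w (\1_A w * D t.+1 w) <= \int[P]_w (\1_A w * D t w) -
    2 * mu * eta t.+1 * \int[P]_w (\1_A w * D t w) +
    eta t.+1 ^+ 2 * \int[P]_w \1_A w.
Proof.
move=> FA; have mA := Fsub _ _ FA.
pose v i w := (theta t w - theta_dag) ord0 i.
pose K := Num.sqrt (d%:R / mu ^+ 2).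
have vK i w : `|v i w| <= K.
  rewrite -sqrtr_sqr ler_sqrt ?divr_ge0 ?sqr_ge0//.
  exact: le_trans (sqr_coord_le_dot _ i) (DK t w).
have mt := measurable_wrt_iterate t.
have mv i : measurable_wrt <<s gen t >> (v i).
  apply/measurable_wrtP; rewrite /v; under eq_fun do rewrite !mxE.
  apply: measurable_funB => //.
  by apply: (measurableT_comp (measurable_coord i)); exact/measurable_wrtP.
have mU i : measurable_wrt <<s gen t >> (fun w => \1_A w * v i w).
  apply/measurable_wrtP; apply: measurable_funM; last exact/measurable_wrtP.
  exact: measurable_indic.
have UK i w : `|\1_A w * v i w| <= K.
  by rewrite normrM -[K]mul1r ler_pM// norm_indic_le1.
have bounded_prod i (f : Omega -> R) : measurable_fun setT f ->
    (forall w, `|f w| <= 1) ->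
    P.-integrable setT (EFin \o (fun w => \1_A w * v i w * f w)).
  move=> mf f1; apply: (bounded_integrable _ _ K).
    by apply: measurable_funM => //; exact: measurable_wrt_fun (Fsub t) (mU i).
  by move=> w; rewrite normrM -[K]mulr1 ler_pM.
have iG i : P.-integrable setT
    (EFin \o (fun w => \1_A w * v i w * g i (theta t w) (Z_ t.+1 w))).
  apply: bounded_prod => [|w]; last exact: g1.
  exact: (measurable_frozen P _ (Fsub t) (theta t) (Z_ t.+1) mt (g i) (mg i)).
have ih i : P.-integrable setT
    (EFin \o (fun w => \1_A w * v i w * h (theta t w) ord0 i)).
  apply: bounded_prod => [|w]; last exact: h1.
  apply: (measurableT_comp (measurable_coord i)); apply: (measurableT_comp mh).
  exact: measurable_wrt_fun (Fsub t) mt.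
have sumE (f : Omega -> 'rV[R]_d) w :
    \1_A w * dot (theta t w - theta_dag) (f w) =
    \sum_(i < d) \1_A w * v i w * f w ord0 i.
  by rewrite mulr_sumr; apply: eq_bigr => i _; rewrite mulrA.
have sumI f : \int[P]_w (\1_A w * dot (theta t w - theta_dag) (f w)) =
    \int[P]_w (\sum_(i < d) \1_A w * v i w * f w ord0 i).
  by apply: eq_Rintegral => w _; exact: sumE.
(* The inner product is split into coordinates; in each, the bounded weight [\1_A w * v i w] is
   known at time t, so freezing turns G into its mean h. *)
have cross : \int[P]_w (\1_A w * dot (theta t w - theta_dag)
      (G (theta t w) (Z_ t.+1 w))) =
    \int[P]_w (\1_A w * dot (theta t w - theta_dag) (h (theta t w))).
  rewrite (sumI (fun w => G (theta t w) (Z_ t.+1 w))) (sumI (fun w => h (theta t w))).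
  rewrite !Rintegral_sum//; apply: eq_bigr => i _.
  rewrite (freezing_weighted P _ (Fsub t) (theta t) (Z_ t.+1) P0 mt (condZ t)
    (g i) _ (mg i) (g1 i) _ _ (mU i) (UK i)).
  by apply: eq_Rintegral => w _; rewrite hE.
have icross (f : Omega -> 'rV[R]_d) :
    (forall i, P.-integrable setT (EFin \o (fun w => \1_A w * v i w * f w ord0 i))) ->
    P.-integrable setT
      (EFin \o (fun w => \1_A w * dot (theta t w - theta_dag) (f w))).
  move=> fi; have := integrable_sum_EFin P _ fi (index_enum 'I_d).
  by congr integrable; apply/funext => w /=; rewrite sumE.
have iIA := integrable_indic P mA.
have iDt := integrable_D A t mA.
have ivG := icross _ iG; have ivh := icross _ ih.
have iaG := integrableZl measurableT (- (2 * eta t.+1)) ivG.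
have ibA := integrableZl measurableT (eta t.+1 ^+ 2) iIA.
have iaGbA := integrableD measurableT iaG ibA.
have step : \int[P]_w (\1_A w * D t.+1 w) <= \int[P]_w (\1_A w * D t w +
    (- (2 * eta t.+1) * (\1_A w * dot (theta t w - theta_dag)
      (G (theta t w) (Z_ t.+1 w))) + eta t.+1 ^+ 2 * \1_A w)).
  apply: le_Rintegral => //.
  - exact: integrable_D.
  - exact: (integrableD measurableT iDt iaGbA).
  move=> w _; have := dist2_step t w.
  rewrite indicE; case: (_ \in _); last by rewrite !mul0r !mulr0 !addr0.
  rewrite !mul1r mulr1; lra.
have drift_int : mu * \int[P]_w (\1_A w * D t w) <=
    \int[P]_w (\1_A w * dot (theta t w - theta_dag) (h (theta t w))).
  rewrite -RintegralZl//; apply: le_Rintegral => //.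
    exact: (integrableZl measurableT mu iDt).
  move=> w _; rewrite mulrCA ler_wpM2l ?indicE//.
  by rewrite /D -sqr_l2norm; apply: drift; exact: iterate_in.
move: step; rewrite RintegralD// RintegralD// !RintegralZl// cross.
have := eta0 t; nra.
Qed.

Hypotheses (eta_sum : (\sum_(1 <= t <oo) (eta t)%:E = +oo)%E)
  (eta_sum2 : (\sum_(1 <= t <oo) (eta t ^+ 2)%:E < +oo)%E).

Lemma sgd_cvg : {ae P, forall w, theta t w @[t --> \oo] --> theta_dag}.
Proof.
have [r [r0 rS r_cvg]] := series_tail _ (fun t => sqr_ge0 (eta t)) eta_sum2.
pose S t w := D t w + r t.
have r_le t : r t <= r 0%N.
  elim: t => // t; apply: le_trans; rewrite [leRHS]rS lerDl; exact: sqr_ge0.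
have mS t : measurable_wrt <<s gen t >> (S t).
  by apply/measurable_wrtP; apply: measurable_funD => //; exact/measurable_wrtP.
have S0 t w : 0 <= S t w by rewrite addr_ge0.
have SC t w : S t w <= d%:R / mu ^+ 2 + r 0%N by rewrite lerD.
have SE t A : measurable A -> \int[P]_w (\1_A w * S t w) =
    \int[P]_w (\1_A w * D t w) + \int[P]_w \1_A w * r t.
  move=> mA; rewrite -RintegralZr//; last exact: integrable_indic.
  rewrite -RintegralD//; [|exact: integrable_D|]; last first.
    exact: (integrable_indicM _ _ (cst (r t)) `|r t|).
  by apply: eq_Rintegral => w _; rewrite mulrDr.
(* The drop of r from t to t + 1 is eta_(t+1)^2, which cancels the noise term. *)
have step t A : <<s gen t >> A -> \int[P]_w (\1_A w * S t.+1 w) <=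
    \int[P]_w (\1_A w * S t w) -
    2 * mu * eta t.+1 * \int[P]_w (\1_A w * D t w).
  move=> FA; rewrite !SE; [|exact: Fsub FA..].
  have := expected_dist2_step t A FA; rewrite (rS t); lra.
have ED0 A t : 0 <= \int[P]_w (\1_A w * D t w).
  by apply: Rintegral_ge0 => w _; rewrite mulr_ge0.
have Ssuper t A : <<s gen t >> A ->
    \int[P]_w (\1_A w * S t.+1 w) <= \int[P]_w (\1_A w * S t w).
  move=> FA; apply: le_trans (step _ _ FA) _; rewrite gerBl.
  by rewrite !mulr_ge0// ltW.
have ES e : 0 < e -> exists T, \int[P]_w S T w < e.
  move=> e0; pose b t := \int[P]_w (\1_setT w * S t w).
  have bE t : b t = \int[P]_w S t w.
    by apply: eq_Rintegral => w _; rewrite indicT mul1r.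
  pose a t := 2 * mu * \int[P]_w (\1_setT w * D t w).
  have a0 t : 0 <= a t by rewrite !mulr_ge0// ltW.
  have b0 t : 0 <= b t by apply: Rintegral_ge0 => w _; rewrite mulr_ge0.
  have decr t : b t.+1 + eta t.+1 * a t <= b t.
    have := step t setT (@measurableT _ (g_sigma_algebraType (gen t))).
    by rewrite /a /b; lra.
  have [N _ rN] : \forall t \near \oo, r t < e / 2.
    have := cvgr_lt _ r_cvg (e / 2); apply; lra.
  (* The bound 2 mu E[D_T] < mu e gives E[D_T] < e / 2, and T >= N gives r T < e / 2. *)
  have [|T NT aT] := summable_decrease_small _ _ _ a0 b0 eta0 eta_sum decr (mu * e) N.
    by rewrite mulr_gt0.
  exists T; rewrite -bE /b SE//.
  have -> : \int[P]_w (\1_setT w : R) = 1.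
    by rewrite /Rintegral integral_indic// setIT [X in fine X]probability_setT.
  have := rN T NT; move: aT; rewrite /a /=.
  rewrite -mulrA mulrCA ltr_pM2l//; lra.
have := supermartingale_cvg0 P gen Fsub (@filtration_mono _ _ _ _ _ _ _ P theta0 Z_)
  S _ mS S0 SC Ssuper ES.
apply: filterS => w Sw; apply/cvgrPdist_lt => /= e e0.
have e20 : 0 < e ^+ 2 by rewrite exprn_gt0.
(* The squared sup-norm distance is at most D_t <= S_t, so the threshold for S is e^2. *)
have [N _ SN] := cvgr_lt _ Sw _ e20.
exists N => // t Nt; rewrite -(ltr_pXn2r (ltn0Sn 1)) ?nnegrE ?(ltW e0)//.
rewrite distrC; apply: le_lt_trans (sqr_norm_le_dot _) _.
by apply: le_lt_trans (SN t Nt); rewrite lerDl.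
Qed.

End projected_sgd.

Theorem proposition1
  (R : realType) (d : nat)
  (dZ : measure_display) (Z : measurableType dZ) (P0 : probability Z R)
  (W : Type) (loss : 'rV[R]_d -> Z -> W -> R) (Wref : Z -> W)
  (loss_diff : forall z w theta,
    differentiable (fun theta' => loss theta' z w) theta)
  (G : 'rV[R]_d -> Z -> 'rV[R]_d) (G_def : G = clipped_field loss Wref)
  (h : 'rV[R]_d -> 'rV[R]_d) (h_def : h = mean_field P0 G)
  (* U1 *)
  (dO : measure_display) (Omega : measurableType dO) (P : probability Omega R)
  (theta0 : {RV P >-> 'rV[R]_d}) (Z_ : nat -> {RV P >-> Z})
  (F : nat -> set (set Omega)) (F_def : F = natural_filtration theta0 Z_)
  (U1 : forall t, conditional_distribution P (F t) (Z_ t.+1) P0)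
  (* U2 *)
  (U2_meas : measurable_fun setT (fun p : 'rV[R]_d * Z => G p.1 p.2))
  (U2_bound : forall theta z, l2norm (G theta z) <= 1)
  (* U3 *)
  (B : set 'rV[R]_d) (B_nonempty : B !=set0) (B_closed : closed B)
  (B_convex : convex_set (B : set (convex_lmodType 'rV[R]_d)))
  (theta_dag : 'rV[R]_d) (theta_dag_B : B theta_dag)
  (h_theta_dag : h theta_dag = 0)
  (mu : R) (mu_gt0 : 0 < mu)
  (U3 : forall theta, B theta ->
    mu * l2norm (theta - theta_dag) ^+ 2 <= dot (theta - theta_dag) (h theta))
  (* U4 *)
  (eta : nat -> R) (eta_gt0 : forall t, (1 <= t)%N -> 0 < eta t)
  (eta_sum : (\sum_(1 <= t <oo) (eta t)%:E = +oo)%E)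
  (eta_sum2 : (\sum_(1 <= t <oo) (eta t ^+ 2)%:E < +oo)%E)
  (eta_small : \forall t \near \oo, eta t <= 1 / (2 * mu))
  (theta0_B : forall w, B (theta0 w))
  (theta : nat -> Omega -> 'rV[R]_d)
  (theta_def : theta = projected_sgd B eta G theta0 Z_)
  (xi : nat -> Omega -> 'rV[R]_d)
  (xi_def : xi = fun t w => G (theta t w) (Z_ t.+1 w) - h (theta t w)) :
  martingale_difference P F xi /\
  {ae P, forall w, theta t w @[t --> \oo] --> theta_dag}.
Proof.
have eta_pos t : 0 < eta t.+1 by exact: eta_gt0.
subst theta xi h F; split; first exact: sgd_martingale_difference.
exact: (sgd_cvg P P0 G U2_meas U2_bound theta0 Z_ U1 B B_nonempty B_closed B_convex
  eta theta_dag mu theta_dag_B mu_gt0 U3 theta0_B eta_pos eta_sum eta_sum2).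
Qed.
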